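(* Let $w$ be a finite word over the alphabet $\{a,b\}$, let $s(w)$ denote the number of distinct nonempty squares in $w$, and let $k$ denote the minimum of the number of occurrences of $a$ in $w$ and the number of occurrences of $b$ in $w$. If $k\geq 2$, then $$s(w)\leq \frac{2k-1}{2k+2}\,|w|.$$
   Context: $|w|$ is the length of $w$. A word $u$ is a factor of $w$ if $w=pus$ for some (possibly empty) words $p,s$. A square is a word of the form $uu$; $s(w)$ is the number of distinct nonempty words that are squares and are factors of $w$. *)

(* Defs.v *)
From mathcomp Require Import all_boot all_order all_algebra.

Set Implicit Arguments.
Unset Strict Implicit.
Unset Printing Implicit Defensive.

(* Words over {a, b} are sequences of booleans: a is true, b is false. *)
Notation word := (seq bool).

Definition factors (w : word) : seq word :=
  [seq take l (drop i w) | i <- iota 0 (size w).+1, l <- iota 0 (size w).+1].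

Definition is_square (x : word) : bool :=
  let u := take (size x)./2 x in x == u ++ u.

Definition squares (w : word) : seq word :=
  undup [seq x <- factors w | is_square x & x != [::]].

Definition num_squares (w : word) : nat := size (squares w).

Lemma factorsP (w x : word) :
  reflect (exists p s, w = p ++ x ++ s) (x \in factors w).
Proof.
apply: (iffP allpairsP) => [[[i l] /= [_ _ ->]]|[p [s ->]]].
  by exists (take i w), (drop l (drop i w)); rewrite !cat_take_drop.
exists (size p, size x); rewrite !mem_iota !size_cat /= !add0n !ltnS.
by rewrite leq_addr addnCA leq_addr drop_size_cat // take_size_cat.
Qed.

Lemma is_squareP (x : word) : reflect (exists u, x = u ++ u) (is_square x).
Proof.
apply: (iffP eqP) => [{1}->|[u ->]]; first by exists (take (size x)./2 x).
by rewrite size_cat addnn doubleK take_size_cat.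
Qed.

Lemma squaresP (w x : word) :
  reflect [/\ x <> [::], exists u, x = u ++ u & exists p s, w = p ++ x ++ s]
          (x \in squares w).
Proof.
rewrite mem_undup mem_filter -andbA.
apply: (iffP and3P) => [[/is_squareP sx /eqP x0 /factorsP fx]|[x0 sx fx]].
  by split.
by split; [apply/is_squareP | apply/eqP | apply/factorsP].
Qed.

Lemma squares_uniq (w : word) : uniq (squares w).
Proof. exact: undup_uniq. Qed.

(* Main.v *)
(* Write 0 for [false] and 1 for [true]. In the Rauzy graph G_N of w, with the
   factors of length N as edges and those of length N-1 as vertices, a set R_N
   of edges whose removal keeps G_N connected has at most C(N) - C(N-1) + 1
   elements, where C(N) is the number of factors of length N; summing over N, at
   most |w| edges can be removed altogether. Read a word as a binary number. An
   edge is removable if it is the least edge of a circuit; such are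
   - for a Lyndon word u with |u| <= N all of whose cyclic factors of length N
     occur in w, the prefix of length N of u^oo (it determines u because Lyndon
     words are unbordered);
   - 0^(N-1) 1, if 0^(N-1) occurs again later in w.
   If r conjugates of u^(2m), |u| = p, occur in w then all the cyclic factors of
   u of length at most (2m-1)p + r do, so the squares other than powers of 0 inject
   into the first kind of edges with N > p. If L >= M are the two longest runs
   of 0, the powers of 0 give L edges but only L/2 squares, and 0^j 1 with j <= M
   gives M + 1 edges that come from no square. Thus
   s(w) + (L - L/2) + M + 1 <= |w|, which yields the bound with k the number of
   1's, unless M = L and nearly all the k + 1 runs have length L. In that case
   four consecutive runs are L,L,L,L or L,x,L,z with x < L, x <= z, and the edge
   of u = 0^L 1 with N = 2p+1, respectively of u = 0^L 1 0^x 1 with N = p, is one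
   more edge that comes from no square. *)
Require Import Defs.
From mathcomp Require Import all_boot all_order all_algebra.
From mathcomp Require Import zify.
Import Order.TTheory GRing.Theory Num.Theory.

Set Implicit Arguments.
Unset Strict Implicit.
Unset Printing Implicit Defensive.

(** * Connectedness of a graph through potentials *)

(** A row vector killed by the incidence matrix is a potential constant along the edges, so by
    connectedness the left kernel is spanned by the all-ones row; rank-nullity concludes. *)
Lemma connected_leq_edges (T S : eqType) (V : seq T) (E : seq S) (s t : S -> T) :
    uniq V ->
    (forall f : T -> rat, {in E, forall e, f (s e) = f (t e)} ->
       {in V &, forall x y, f x = f y}) ->
  size V <= (size E).+1.
Proof.
case: V => [|x0 V'] //; have := mem_head x0 V'.
move: {V'}(x0 :: V') => V x0V uV conn.
pose D : 'M[rat]_(size V, size E) :=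
  (\matrix_(i, j) let e := tnth (in_tuple E) j in
     ((nth x0 V i == s e)%:R - (nth x0 V i == t e)%:R))%R.
have sum_delta (g : 'rV[rat]_(size V)) (y : T) :
  (\sum_i g ord0 i * (nth x0 V i == y)%:R =
   oapp (g ord0) 0 (insub (index y V) : option 'I_(size V)))%R.
  case: insubP => [k ylt /= ky | yge].
    have yV : y \in V by rewrite -index_mem.
    rewrite (bigD1 k) //= ky nth_index // eqxx mulr1 big1 ?addr0 // => i ik.
    case: eqP => [iy|]; rewrite ?mulr0 //; case/negP: ik.
    by apply/eqP/val_inj; rewrite /= ky -iy index_uniq.
  rewrite big1 // => i _; case: eqP => [iy|]; rewrite ?mulr0 //.
  by case/negP: yge; rewrite -iy index_uniq.
have ker1 : (kermx D <= (const_mx 1%R : 'rV[rat]_(size V)))%MS.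
  apply/row_subP => i; set g := row i _.
  have gD : (g *m D = 0)%R by apply/sub_kermxP; apply: row_sub.
  (* The potential is 0 outside [V]: by [sum_delta], end points outside [V] contribute nothing to
     [g *m D]. *)
  pose f y := oapp (g ord0) 0%R (insub (index y V) : option 'I_(size V)).
  have fE : {in E, forall e, f (s e) = f (t e)}.
    move=> e; rewrite -index_mem => elt.
    have := congr1 (fun X : 'rV_(size E) => X ord0 (Ordinal elt)) gD.
    rewrite !mxE.
    under eq_bigr => k _.
      rewrite [D _ _]mxE /= (tnth_nth e) /= nth_index -?index_mem // mulrBr.
      over.
    by rewrite sumrB !sum_delta => /eqP; rewrite subr_eq0 => /eqP.
  have fV (k : 'I_(size V)) : f (nth x0 V k) = g ord0 k.
    rewrite /f index_uniq // insubT //= => klt.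
    by congr (g ord0 _); apply: val_inj.
  apply/sub_rVP; exists (f x0); apply/rowP => k.
  rewrite 2![in RHS]mxE mulr1 -fV.
  by apply: (conn f fE); rewrite ?mem_nth.
have := leq_trans (mxrankS ker1) (rank_leq_row _).
rewrite mxrank_ker leq_subLR => /leq_trans; apply.
by rewrite addn1 ltnS rank_leq_col.
Qed.

(** * Words as binary numbers *)

Fixpoint binval (x : word) : nat :=
  if x is b :: y then b * 2 ^ size y + binval y else 0.

Lemma binval_lt x : binval x < 2 ^ size x.
Proof. by elim: x => [|[] x IHx] //=; rewrite expnS; lia. Qed.

Lemma binval_cat x y : binval (x ++ y) = binval x * 2 ^ size y + binval y.
Proof.
by elim: x => [|b x IHx] //=; rewrite IHx size_cat expnD mulnDl mulnA addnA.
Qed.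

Lemma binval_inj x y : size x = size y -> binval x = binval y -> x = y.
Proof.
elim: x y => [|b x IHx] [|c y] //= [sxy].
have := binval_lt x; have := binval_lt y; rewrite sxy.
case: b c => [] [] ? ?; rewrite ?mul1n ?mul0n ?add0n; try lia.
  by move/addnI => E; rewrite (IHx y).
by move=> E; rewrite (IHx y).
Qed.

Lemma binval_nth x i : nth false x i -> 2 ^ (size x - i.+1) <= binval x.
Proof.
elim: x i => [|b x IHx] [|i] //=; first by move->; rewrite mul1n subn1 leq_addr.
by move/IHx => /leq_trans; apply; rewrite leq_addl.
Qed.

Lemma binval_nseq0 n : binval (nseq n false) = 0.
Proof. by elim: n. Qed.

Lemma binval_cat_lt x x' y y' :
  size x = size x' -> size y = size y' -> binval x < binval x' ->
  binval (x ++ y) < binval (x' ++ y').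
Proof.
move=> _ syy' lt_xx'; rewrite !binval_cat -syy'; have := binval_lt y.
by have := leq_mul lt_xx' (leqnn (2 ^ size y)); rewrite mulSn; lia.
Qed.

Lemma binval_cat_le x x' y y' :
  size x = size x' -> size y = size y' -> binval (x ++ y) <= binval (x' ++ y') ->
  binval x <= binval x'.
Proof.
move=> sx sy; apply: contraTT; rewrite -!ltnNge.
by apply: binval_cat_lt; rewrite ?sx ?sy.
Qed.

(** * Factors of fixed length and edge removal in Rauzy graphs *)

Definition factors_of_size (w : word) N : seq word :=
  undup [seq x <- factors w | size x == N].

Lemma mem_factors_of_size (w : word) N (x : word) :
  (x \in factors_of_size w N) = (x \in factors w) && (size x == N).
Proof. by rewrite mem_undup mem_filter andbC. Qed.

Lemma factors_trans (x y w : word) :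
  x \in factors y -> y \in factors w -> x \in factors w.
Proof.
move=> /factorsP[p [s ->]] /factorsP[p' [s' ->]]; apply/factorsP.
by exists (p' ++ p), (s ++ s'); rewrite !catA.
Qed.

Lemma factors_cat (p x s : word) : x \in factors (p ++ x ++ s).
Proof. by apply/factorsP; exists p, s. Qed.

Lemma factors_slice (w : word) i l : take l (drop i w) \in factors w.
Proof.
by apply/factorsP; exists (take i w), (drop l (drop i w)); rewrite !cat_take_drop.
Qed.

Lemma factors_size (x w : word) : x \in factors w -> size x <= size w.
Proof. by case/factorsP => p [s ->]; rewrite !size_cat; lia. Qed.

(* In the Rauzy graph whose edges are the factors of length [size e], the end
   points of [e] are joined by a path of edges larger than [e]; paths are
   expressed through potentials [f]. *)
Definition bypassed (w : word) (e : word) : Prop :=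
  forall f : word -> rat,
    (forall x, x \in factors w -> size x = size e -> binval e < binval x ->
       f (take (size e).-1 x) = f (behead x)) ->
  f (take (size e).-1 e) = f (behead e).

(* Deleting the edges of [R] in increasing order never disconnects the graph. *)
Lemma bypassed_count w N R :
    0 < N <= size w -> uniq R -> {in R, forall e, e \in factors_of_size w N} ->
    {in R, forall e, bypassed w e} ->
  size R + size (factors_of_size w N.-1) <= (size (factors_of_size w N)).+1.
Proof.
move=> /andP[N0 Nw] uR RF Rb.
pose E := [seq x <- factors_of_size w N | x \notin R].
have -> : size (factors_of_size w N) = size R + size E.
  rewrite -(count_predC (mem R) (factors_of_size w N)) -!size_filter; congr (_ + _).
  apply/perm_size/uniq_perm; rewrite ?filter_uniq ?undup_uniq // => x.
  by rewrite mem_filter andb_idr //; apply: RF.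
rewrite -addnS leq_add2l.
apply: (@connected_leq_edges _ _ _ _ (take N.-1) behead) => [|f fE].
  exact: undup_uniq.
have fF x : x \in factors_of_size w N -> f (take N.-1 x) = f (behead x).
  (* Induction from the largest edge downwards: once all larger edges respect [f], so does a
     bypassed one. *)
  have [n] := ubnP (2 ^ N - binval x); elim: n x => // n IHn x lexn xF.
  have [xR|xR] := boolP (x \in R); last by apply: fE; rewrite mem_filter xR.
  have sx : size x = N.
    by move: xF; rewrite mem_factors_of_size => /andP[_ /eqP].
  have := Rb x xR f; rewrite sx; apply => y yw sy ltxy.
  apply: IHn; last by rewrite mem_factors_of_size yw sy eqxx.
  by have := binval_lt y; rewrite sy; lia.
(* Reading [w] from left to right is a walk through all vertices. *)
have fw i : i <= size w - N.-1 ->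
    f (take N.-1 (drop i w)) = f (take N.-1 w).
  elim: i => [|i IHi] ltiw; first by rewrite drop0.
  rewrite -IHi; last exact: ltnW.
  have := fF (take N (drop i w)).
  rewrite mem_factors_of_size factors_slice size_takel ?size_drop ?eqxx; last lia.
  move=> /(_ isT); rewrite take_takel ?leq_pred // => ->.
  have ltiw' : i < size w by lia.
  by rewrite (drop_nth false ltiw') -{2}(prednK N0) /=.
suff fV x : x \in factors_of_size w N.-1 -> f x = f (take N.-1 w).
  by move=> x y xV yV; rewrite !fV.
rewrite mem_factors_of_size => /andP[/factorsP[p [s defw]] /eqP sx].
rewrite -(fw (size p)).
  by rewrite defw drop_size_cat // -sx take_size_cat.
by rewrite defw !size_cat -sx; lia.
Qed.

Lemma factors_of_size0 w : size (factors_of_size w 0) = 1.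
Proof.
rewrite (@perm_size _ _ [:: [::]]) //; apply: uniq_perm; rewrite ?undup_uniq //.
move=> x; rewrite mem_factors_of_size mem_seq1 size_eq0 andb_idl // => /eqP->.
by have := factors_slice w 0 0; rewrite take0.
Qed.

Lemma factors_of_size_size w : size (factors_of_size w (size w)) = 1.
Proof.
rewrite (@perm_size _ _ [:: w]) //; apply: uniq_perm; rewrite ?undup_uniq //.
move=> x; rewrite mem_factors_of_size mem_seq1.
apply/andP/eqP => [[/factorsP[p [s ->]]]|->].
  rewrite !size_cat => /eqP sx.
  have: size p = 0 by lia. have: size s = 0 by lia.
  by move=> /size0nil -> /size0nil ->; rewrite cats0.
by split=> //; have := factors_slice w 0 (size w); rewrite drop0 take_size.
Qed.

(** The bounds of [bypassed_count] telescope, and there is exactly one factor of length 0 and one of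
    length [size w]. *)
Lemma bypassed_total w R :
    uniq R -> {in R, forall e, [/\ e != [::], e \in factors w & bypassed w e]} ->
  size R <= size w.
Proof.
move=> uR HR.
pose F j := [seq e <- R | size e <= j].
suff H j : j <= size w -> size (F j) + 1 <= size (factors_of_size w j) + j.
  have := H _ (leqnn _); rewrite factors_of_size_size addnC leq_add2l.
  rewrite /F (_ : filter _ R = R) //; apply/all_filterP/allP => e.
  by case/HR => _ /factors_size.
elim: j => [|j IHj] ltjw.
  rewrite factors_of_size0 /F; suff -> : filter (fun e => size e <= 0) R = [::] by [].
  apply/eqP; rewrite -[_ == _]negbK -has_filter -all_predC.
  by apply/allP => e /HR[e0 _ _] /=; rewrite leqn0 size_eq0.
have := @bypassed_count w j.+1 [seq e <- R | size e == j.+1] ltjw (filter_uniq _ uR).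
rewrite /= => bc.
have {bc} := bc _ _; set c := size (filter _ R) => bc.
have -> : size (F j.+1) = size (F j) + c.
  rewrite /F /c !size_filter.
  elim: R {uR HR F IHj c bc} => //= e R ->.
  by rewrite leq_eqVlt ltnS; have [->|] := eqVneq; rewrite ?ltnn //=; lia.
have: c + size (factors_of_size w j) <= (size (factors_of_size w j.+1)).+1.
  apply: bc => e; rewrite mem_filter => /andP[se /HR[_ ew be]] //.
  by rewrite mem_factors_of_size ew se.
by have := IHj (ltnW ltjw); lia.
Qed.

(** * Cyclic factors and Lyndon words *)

(** The window of length [N] at position [i] of the periodic word u^oo; for [N = size u], a rotation
    of [u]. *)
Definition cyc (u : word) i N : word :=
  mkseq (fun t => nth false u ((i + t) %% size u)) N.

Lemma size_cyc u i N : size (cyc u i N) = N.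
Proof. exact: size_mkseq. Qed.

Lemma nth_cyc u i N t : t < N ->
  nth false (cyc u i N) t = nth false u ((i + t) %% size u).
Proof. exact: nth_mkseq. Qed.

Lemma cyc_mod u i N : cyc u (i %% size u) N = cyc u i N.
Proof. by apply: eq_map => t; rewrite modnDml. Qed.

Lemma eq_cyc u i j N : i = j %[mod size u] -> cyc u i N = cyc u j N.
Proof. by move=> ij; rewrite -cyc_mod ij cyc_mod. Qed.

Lemma cycD u i M N : cyc u i (M + N) = cyc u i M ++ cyc u (i + M) N.
Proof.
rewrite /cyc /mkseq iotaD map_cat; congr (_ ++ _).
by rewrite add0n -[M in iota M]addn0 iotaDl -map_comp; apply: eq_map => t /=; rewrite addnA.
Qed.

Lemma drop_cyc u i d N : drop d (cyc u i N) = cyc u (i + d) (N - d).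
Proof.
have [leNd|/ltnW ledN] := leqP N d.
  by rewrite drop_oversize ?size_cyc // (eqP leNd).
by rewrite -{1}(subnKC ledN) cycD drop_size_cat ?size_cyc.
Qed.

Lemma take_cyc u i d N : d <= N -> take d (cyc u i N) = cyc u i d.
Proof. by move=> ledN; rewrite -{1}(subnKC ledN) cycD take_size_cat ?size_cyc. Qed.

Lemma cyc_factors u i d M N : i + M <= d + N -> d <= i ->
  cyc u i M \in factors (cyc u d N).
Proof.
move=> le1 le2; have := factors_slice (cyc u d N) (i - d) M.
by rewrite drop_cyc take_cyc ?subnKC //; lia.
Qed.

Lemma cyc_size u : cyc u 0 (size u) = u.
Proof.
apply: (@eq_from_nth _ false); rewrite ?size_cyc // => t ltt.
by rewrite nth_cyc // add0n modn_small.
Qed.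

Lemma cyc_shift u i j d N : cyc u i (size u) = cyc u j (size u) ->
  cyc u (i + d) N = cyc u (j + d) N.
Proof.
move=> ij; have [/size0nil->|u0] := posnP (size u).
  by apply: eq_map => t /=; rewrite !nth_nil.
apply: (@eq_from_nth _ false); rewrite ?size_cyc // => t ltt.
rewrite !nth_cyc // -!addnA -modnDmr -[in RHS]modnDmr.
have lt' : (d + t) %% size u < size u by rewrite ltn_mod.
by have := congr1 (nth false ^~ ((d + t) %% size u)) ij; rewrite /= !nth_cyc.
Qed.

(** On words of equal length [binval] gives the lexicographic order, so these are the usual Lyndon
    words, primitive because the inequality is strict. *)
Definition lyndon (u : word) : bool :=
  (u != [::]) &&
  all (fun i => binval u < binval (cyc u i (size u))) (iota 1 (size u).-1).

Lemma lyndonP u :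
  reflect (0 < size u /\
           forall i, 0 < i < size u -> binval u < binval (cyc u i (size u)))
          (lyndon u).
Proof.
rewrite /lyndon -size_eq0 -lt0n; apply: (iffP andP) => -[u0 Hu]; split=> //.
  move=> i ltiu; apply: (allP Hu); rewrite mem_iota; lia.
by apply/allP => i; rewrite mem_iota => ?; apply: Hu; lia.
Qed.

Lemma lyndon_size u : lyndon u -> 0 < size u.
Proof. by case/lyndonP. Qed.

Lemma lyndon_cyc_lt u i N : lyndon u -> 0 < i < size u -> size u <= N ->
  binval (cyc u 0 N) < binval (cyc u i N).
Proof.
move=> /lyndonP[u0 Hu] iu uN; rewrite -(subnKC uN) !cycD.
by apply: binval_cat_lt; rewrite ?size_cyc // cyc_size; apply: Hu.
Qed.

(** Shifting a coincidence of windows at [i < j] by [size u - i] makes the rotation at [j - i] equal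
    to [u], against strict minimality. *)
Lemma lyndon_cyc_inj u i j N : lyndon u -> size u <= N -> i < size u ->
  j < size u -> cyc u i N = cyc u j N -> i = j.
Proof.
move=> lu uN; wlog: i j / i < j => [H|ltij] ltiu ltju eq_ij.
  case: (ltngtP i j) => // lt; first exact: H eq_ij.
  by apply/esym; apply: (H j i) => //; apply: esym.
have := @lyndon_cyc_lt u (j - i) (size u) lu _ (leqnn _).
suff -> : cyc u (j - i) (size u) = cyc u 0 (size u) by rewrite ltnn; lia.
have ij : cyc u i (size u) = cyc u j (size u).
  by rewrite -(take_cyc u i uN) eq_ij take_cyc.
have := cyc_shift (size u - i) (size u) ij.
rewrite subnKC; last exact: ltnW.
move=> E1; rewrite (_ : cyc u 0 _ = cyc u (size u) (size u)); last first.
  by apply: eq_cyc; rewrite modnn mod0n.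
rewrite E1; apply: eq_cyc.
by rewrite -(modnDr (j - i)); congr (_ %% _); lia.
Qed.

(* A Lyndon word is unbordered: from [v = x ++ y = z ++ x], minimality against
   the rotations [x ++ z] and [y ++ x] gives [y < z] and [z < y]. *)
Lemma lyndon_unbordered v q : lyndon v -> 0 < q < size v ->
  drop q v != take (size v - q) v.
Proof.
move=> lv qv; apply/eqP => E.
set x := drop q v; set z := take q v; set y := drop (size v - q) v.
have rotE i : i <= size v -> cyc v i (size v) = drop i v ++ take i v.
  move=> lei; have := cycD v i (size v - i) i; rewrite subnK // subnKC // => ->.
  have := drop_cyc v 0 i (size v); rewrite cyc_size => ->.
  have := take_cyc v 0 lei; rewrite cyc_size => ->.
  by congr (_ ++ _); apply: eq_cyc; rewrite modnn mod0n.
have /lyndonP[_ Hv] := lv.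
have qle : q <= size v by lia.
have H2 := Hv q qv; rewrite rotE // -/x -/z in H2.
have qv' : 0 < size v - q < size v by lia.
have H1 := Hv _ qv'; rewrite rotE ?leq_subr // -/y -E -/x in H1.
have syz : size y = size z by rewrite size_drop size_takel; lia.
move: H2; rewrite -{1}(cat_take_drop (size v - q) v) -E -/x -/y.
move: H1; rewrite -{1}(cat_take_drop q v) -/x -/z.
rewrite !binval_cat syz ltn_add2r ltn_add2l ltn_mul2r => /andP[_ /ltnW].
by rewrite ltnNge => ->.
Qed.

(** If [u] were shorter than [v], then [v] would be a prefix of u^oo, hence bordered. *)
Lemma lyndon_prefix_inj u v N : lyndon u -> lyndon v ->
  size u <= N -> size v <= N -> cyc u 0 N = cyc v 0 N -> u = v.
Proof.
wlog: u v / size u <= size v => [H lu lv uN vN E|le_uv lu lv uN vN E].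
  by case: (leqP (size u) (size v)) => [|/ltnW] le; [|apply/esym]; apply: H.
move: le_uv; rewrite leq_eqVlt => /predU1P[suv|lt_uv].
  by rewrite -(cyc_size u) -(cyc_size v) -(take_cyc u 0 uN) E suv take_cyc.
have uv : v = cyc u 0 (size v).
  by rewrite -[LHS]cyc_size -(take_cyc v 0 vN) -E take_cyc.
have /negP[] := lyndon_unbordered lv (introT andP (conj (lyndon_size lu) lt_uv)).
rewrite [in drop _ _]uv [in take _ _]uv size_cyc drop_cyc take_cyc ?leq_subr //.
by apply/eqP; apply: eq_cyc; rewrite add0n modnn mod0n.
Qed.

Definition cyc_in (w u : word) N : Prop :=
  forall i, i < size u -> cyc u i N \in factors w.

(** * Two kinds of bypassed edges *)

(** The windows of u^oo form a circuit whose least edge is the one at position 0; the other edges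
    lead around it. *)
Lemma cyc_bypassed w u N : lyndon u -> size u <= N ->
  cyc_in w u N -> bypassed w (cyc u 0 N).
Proof.
move=> lu uN Hw f; rewrite size_cyc => Hf.
have u0 := lyndon_size lu; have N0 : 0 < N by lia.
have e i : take N.-1 (cyc u i N) = cyc u i N.-1 by rewrite take_cyc ?leq_pred.
have b i : behead (cyc u i N) = cyc u i.+1 N.-1.
  by rewrite -drop1 drop_cyc addn1 subn1.
rewrite e b; have H j : 0 < j <= size u -> f (cyc u j N.-1) = f (cyc u 1 N.-1).
  elim: j => [|[|j] IHj] // ltju; rewrite -IHj; last by lia.
  have := Hf (cyc u j.+1 N); rewrite e b => -> //; rewrite ?size_cyc //.
    by apply: Hw; lia.
  by apply: lyndon_cyc_lt; lia.
rewrite -(H (size u)) ?u0 ?leqnn //; congr f; apply: eq_cyc.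
by rewrite modnn mod0n.
Qed.

(** After 0^j 1, follow [w] up to the first return to 0^j. The edges on the way do not start with
    0^j, so their value is at least 2, while 0^j 1 has value 1. *)
Lemma nseq_true_bypassed w j p q :
    w = p ++ nseq j false ++ true :: q -> nseq j false \in factors q ->
  bypassed w (rcons (nseq j false) true).
Proof.
move=> defw /factorsP[q1 [q2 defq]] f; rewrite size_rcons size_nseq /= => Hf.
set z := nseq j false ++ true :: q.
have zw l i : take l (drop i z) \in factors w.
  apply: factors_trans (factors_slice z i l) _; rewrite defw.
  by apply/factorsP; exists p, [::]; rewrite cats0.
pose P i := (0 < i) && (take j (drop i z) == nseq j false).
have Pi0 : P (j.+1 + size q1).
  rewrite /P addSn /= -addSn addnC -drop_drop /z -cat_rcons.
  rewrite drop_size_cat ?size_rcons ?size_nseq //.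
  by rewrite defq drop_size_cat // take_size_cat ?size_nseq.
have szP : exists i, P i && (i + j <= size z).
  exists (j.+1 + size q1); rewrite Pi0 /z defq size_cat /= !size_cat !size_nseq.
  by lia.
case: (ex_minnP szP) => i /andP[/andP[i0 /eqP Pi] iz] imin {szP}.
have v0 : take j (drop 0 z) = nseq j false.
  by rewrite drop0 take_size_cat ?size_nseq.
have bh k : k + j < size z -> behead (take j.+1 (drop k z)) = take j (drop k.+1 z).
  by move=> kz; rewrite (drop_nth false) //; lia.
have e0 : rcons (nseq j false) true = take j.+1 (drop 0 z).
  by rewrite drop0 /z -cat_rcons take_size_cat ?size_rcons ?size_nseq.
rewrite e0 bh; last by rewrite /z size_cat size_nseq /=; lia.
rewrite take_takel // v0 -Pi.
have H k : 0 < k <= i -> f (take j (drop k z)) = f (take j (drop 1 z)).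
  elim: k => [|[|k] IHk] // ltk; rewrite -IHk; last by lia.
  rewrite -bh; last by lia.
  have := Hf (take j.+1 (drop k.+1 z)); rewrite take_takel // => <- //.
    by rewrite size_takel // size_drop; lia.
  rewrite -cats1 binval_cat binval_nseq0 /= mul0n add0n addn0 mul1n expn0.
  rewrite ltnNge; apply/negP => le1.
  suff /imin : P k.+1 && (k.+1 + j <= size z) by lia.
  rewrite /P /=; apply/andP; split; last by lia.
  apply/eqP/binval_inj; first by rewrite size_nseq size_takel // size_drop; lia.
  move: le1; rewrite -[X in binval X](cat_take_drop j) take_takel // binval_cat binval_nseq0.
  rewrite size_drop size_takel ?size_drop; last by lia.
  by rewrite subSnn expn1; lia.
by rewrite H // i0 leqnn.
Qed.

(** * Lyndon roots of squares *)

Lemma cyc_cyc u i j N : cyc (cyc u i (size u)) j N = cyc u (i + j) N.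
Proof.
have [/size0nil->|u0] := posnP (size u).
  by apply: eq_map => t /=; rewrite !nth_nil.
apply: (@eq_from_nth _ false); rewrite ?size_cyc // => t ltt.
by rewrite !nth_cyc ?size_cyc ?ltn_mod // modnDmr addnA.
Qed.

Lemma min_rotation (z : word) : 0 < size z -> exists2 i, i <= size z &
  forall j, binval (cyc z i (size z)) <= binval (cyc z j (size z)).
Proof.
move=> z0.
have ex : exists b, has (fun i => binval (cyc z i (size z)) == b) (iota 0 (size z).+1).
  by exists (binval (cyc z 0 (size z))); apply/hasP; exists 0; rewrite ?mem_iota.
case: (ex_minnP ex) => b /hasP[i]; rewrite mem_iota ltnS => /andP[_ lei] /eqP <- min.
exists i => // j; apply: min; apply/hasP; exists (j %% size z); last by rewrite cyc_mod.
by rewrite mem_iota /= ltnS; apply: ltnW; rewrite ltn_mod.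
Qed.

(** [u] is the prefix of [v] whose length is the least positive shift fixing [v] cyclically;
    leastness turns the weak inequalities into strict ones. *)
Lemma lyndon_root (v : word) : v != [::] ->
    (forall j, binval v <= binval (cyc v j (size v))) ->
  exists u, [/\ lyndon u, size u %| size v & forall i N, cyc v i N = cyc u i N].
Proof.
rewrite -size_eq0 -lt0n => v0 vmin; set n := size v.
have ex : exists p, (0 < p) && (cyc v p n == cyc v 0 n).
  by exists n; rewrite v0; apply/eqP/eq_cyc; rewrite modnn mod0n.
case: (ex_minnP ex) => p /andP[p0 /eqP vp] pmin {ex}.
have vkp k i N : cyc v (k * p + i) N = cyc v i N.
  by elim: k => // k IHk; rewrite mulSn -addnA (cyc_shift _ _ vp) add0n.
have vmodp i N : cyc v i N = cyc v (i %% p) N by rewrite {1}(divn_eq i p) vkp.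
have pn : p %| n.
  apply: contraT; rewrite /dvdn -lt0n => r0.
  have : p <= n %% p.
    apply: pmin; rewrite r0 -vmodp; apply/eqP.
    by apply: eq_cyc; rewrite modnn mod0n.
  by rewrite leqNgt ltn_pmod.
have pn' : p <= n := dvdn_leq v0 pn.
pose u := cyc v 0 p; have su : size u = p by rewrite size_cyc.
have vu i N : cyc v i N = cyc u i N.
  apply: (@eq_from_nth _ false); rewrite ?size_cyc // => t ltt.
  have lt' : (i + t) %% p < p by rewrite ltn_pmod.
  rewrite !nth_cyc ?su // add0n.
  by have := congr1 (nth false ^~ 0) (vmodp (i + t) 1); rewrite /= !addn0.
exists u; split=> //; last by rewrite su.
apply/lyndonP; rewrite su; split=> // j /andP[j0 jp].
rewrite ltn_neqAle; apply/andP; split.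
  apply/negP => /eqP/binval_inj; rewrite su size_cyc => /(_ erefl) uj.
  have: p <= j; last by lia.
  apply: pmin; rewrite j0 !vu; apply/eqP.
  rewrite -[j]addn0 -[X in _ = cyc u X _](addn0 0); apply: cyc_shift.
  by rewrite su -uj -su cyc_size.
have := vmin j; rewrite -{1}[v]cyc_size -[size v](subnKC pn') !cycD -vu.
by apply: binval_cat_le; rewrite !size_cyc.
Qed.

(** [x] is a conjugate of an even power of the Lyndon word [u]. *)
Definition is_sqroot (x u : word) : bool :=
  [&& lyndon u, (size u).*2 %| size x
    & x \in [seq cyc u i (size x) | i <- iota 0 (size u)]].

Lemma square_has_sqroot (w x : word) : x \in squares w -> exists u, is_sqroot x u.
Proof.
case/squaresP => x0 [z defx] _; have z0 : 0 < size z by case: z defx.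
have [i0 lei0 vmin] := min_rotation z0; set v := cyc z i0 (size z) in vmin.
have sv : size v = size z by rewrite size_cyc.
have [||u [lu uv vu]] := @lyndon_root v.
- by rewrite -size_eq0 sv -lt0n.
- by move=> j; rewrite sv cyc_cyc; apply: vmin.
have sx : size x = (size z).*2 by rewrite defx size_cat addnn.
exists u; apply/and3P; split=> //; first by rewrite sx -!muln2 dvdn_pmul2r // -sv.
(* Rotating by [size z - i0] undoes the rotation by [i0] that made [z] minimal. *)
apply/mapP; exists ((size z - i0) %% size u).
  by rewrite mem_iota ltn_mod lyndon_size.
rewrite cyc_mod -vu cyc_cyc subnKC // sx -addnn cycD {1}defx.
have E j : cyc z (j * size z) (size z) = z.
  by rewrite -[RHS]cyc_size; apply: eq_cyc; rewrite modnMl mod0n.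
by have := E 1; have := E 2; rewrite mul1n mul2n -addnn => -> ->.
Qed.

(** Searching the factors of [x] suffices: a nonempty [x] has length at least twice that of its root
    [u], so it contains [u]. *)
Definition sqroot (x : word) : word := head [::] [seq u <- factors x | is_sqroot x u].

Lemma sqrootP (w x : word) : x \in squares w -> is_sqroot x (sqroot x).
Proof.
move=> xw; have [u xu] := square_has_sqroot xw.
have ux : u \in factors x.
  have [lu /dvdn_leq ux /mapP[i]] := and3P xu.
  have {}ux : (size u).*2 <= size x.
    by apply: ux; case/squaresP: xw; case: (x).
  rewrite mem_iota /= add0n => ltiu ->.
  rewrite -[X in X \in _]cyc_size (@eq_cyc _ 0 (size u)) ?modnn ?mod0n //.
  by apply: cyc_factors; lia.
rewrite /sqroot; have: u \in [seq u <- factors x | is_sqroot x u] by rewrite mem_filter xu.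
have: all (is_sqroot x) [seq u <- factors x | is_sqroot x u] by apply: filter_all.
by case: [seq u <- _ | _] => //= v s /andP[].
Qed.

Lemma is_sqrootP (w x : word) : x \in squares w ->
  [/\ lyndon (sqroot x), exists2 m, 0 < m & size x = (size (sqroot x)).*2 * m
    & exists2 i, i < size (sqroot x) & x = cyc (sqroot x) i (size x)].
Proof.
move=> xw; have [lu /dvdnP[m sx] /mapP[i]] := and3P (sqrootP xw).
rewrite mem_iota /= => ltiu defx; split=> //; last by exists i.
exists m; last by rewrite mulnC.
by case: m sx => //; case/squaresP: xw; case: (x).
Qed.

(** * Injection of squares into edges *)

Definition square_class (w x : word) : seq word :=
  [seq y <- squares w | (size y == size x) && (sqroot y == sqroot x)].

(** Ranks start at 1, so with p the length of the root, the edges of squares of length 2mp have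
    lengths in the interval from (2m-1)p+1 to 2mp; these intervals are disjoint for distinct m. *)
Definition square_rank (w x : word) : nat := (index x (square_class w x)).+1.

(* The squares of length [2 m p] conjugate to [u ^ (2 m)], where [p = size u],
   are sent to the prefixes of [u ^ oo] of lengths [(2 m - 1) p + 1], [+ 2], ... *)
Definition square_edge (w x : word) : word :=
  cyc (sqroot x) 0 (size x - size (sqroot x) + square_rank w x).

Lemma square_rank_class (w x : word) : x \in squares w ->
  square_rank w x <= size (square_class w x).
Proof. by move=> xw; rewrite /square_rank index_mem mem_filter !eqxx. Qed.

Lemma square_classP (w x y : word) : y \in square_class w x ->
  exists2 i, i < size (sqroot x) & y = cyc (sqroot x) i (size x).
Proof.
rewrite mem_filter => /andP[/andP[/eqP sy /eqP ry] yw].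
by have [_ _] := is_sqrootP yw; rewrite sy ry.
Qed.

Lemma square_class_uniq (w x : word) : uniq (square_class w x).
Proof. exact/filter_uniq/squares_uniq. Qed.

Lemma size_square_class (w x : word) : size (square_class w x) <= size (sqroot x).
Proof.
rewrite -(size_iota 0 (size (sqroot x))) -(size_map (fun i => cyc (sqroot x) i (size x))).
apply: uniq_leq_size; first exact: square_class_uniq.
move=> y /square_classP[i lti ->]; apply/mapP; exists i => //.
by rewrite mem_iota.
Qed.

Lemma square_rank_bound (w x : word) : x \in squares w ->
  0 < square_rank w x <= size (sqroot x).
Proof.
by move=> xw; rewrite (leq_trans (square_rank_class xw)) ?size_square_class.
Qed.

Lemma squares_factors (w x : word) : x \in squares w -> x \in factors w.
Proof. by rewrite mem_undup mem_filter => /andP[]. Qed.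

(** Pigeonhole: the window at [i] lies inside each of p-r+1 conjugates of the square, and at least r
    of the p conjugates occur in [w]. *)
Lemma square_edge_in (w x : word) : x \in squares w ->
  cyc_in w (sqroot x) (size x - size (sqroot x) + square_rank w x).
Proof.
move=> xw i ltiu; set u := sqroot x in ltiu *; set p := size u in ltiu *.
set r := square_rank w x.
have /andP[r0 rp] := square_rank_bound xw; rewrite -/u -/p -/r in r0 rp.
have [lu [m m0 sx] _] := is_sqrootP xw; rewrite -/u -/p in lu sx.
(* The conjugates starting [d <= p - r] positions before [i]; adding [p] keeps the subtraction from
   truncating. *)
pose T := [seq cyc u ((i + p - d) %% p) (size x) | d <- iota 0 (p - r).+1].
have px : p.*2 <= size x by rewrite sx leq_pmulr.
have uT : uniq T.
  rewrite map_inj_in_uniq ?iota_uniq // => d d'; rewrite !mem_iota /= => ltd ltd'.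
  move/(lyndon_cyc_inj lu); rewrite -/p !ltn_mod => /(_ ltac:(lia) ltac:(lia) ltac:(lia)).
  (* Adding [d + d'] clears both subtractions and leaves a congruence between [d] and [d'], both
     below [p]. *)
  move=> E; have : i + p - d + (d + d') = i + p - d' + (d + d') %[mod p].
    by rewrite -modnDml E modnDml.
  rewrite (_ : _ + (d + d') = (i + p) + d'); last by lia.
  rewrite [in RHS](_ : _ + (d + d') = (i + p) + d); last by lia.
  by move/eqP; rewrite eqn_modDl !modn_small => [/eqP//||]; lia.
have [|nST] := boolP (has (mem (square_class w x)) T).
  case/hasP => _ /mapP[d + ->] /=; rewrite mem_iota /= mem_filter => ltd.
  case/andP => _ /squares_factors /(factors_trans _); apply.
  rewrite cyc_mod (@eq_cyc _ i (i + p - d + d)); last first.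
    by rewrite subnK ?modnDr //; lia.
  by apply: cyc_factors; lia.
have: size (square_class w x ++ T) <= p.
  rewrite -(size_iota 0 p) -(size_map (fun i => cyc u i (size x))).
  apply: uniq_leq_size.
    by rewrite cat_uniq square_class_uniq uT nST.
  move=> y; rewrite mem_cat => /orP[/square_classP[j ltj ->]|/mapP[d _ ->]].
    by apply/mapP; exists j; rewrite ?mem_iota.
  by apply/mapP; exists ((i + p - d) %% p); rewrite // mem_iota ltn_mod lyndon_size.
rewrite size_cat size_map size_iota; have := square_rank_class xw; rewrite -/r; lia.
Qed.

(** The edge determines the root by [lyndon_prefix_inj]; its length then determines m and the rank,
    and the rank determines the square in its class. *)
Lemma square_edge_inj (w x y : word) : x \in squares w -> y \in squares w ->
  square_edge w x = square_edge w y -> x = y.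
Proof.
move=> xw yw; rewrite /square_edge => E.
have [lx [m m0 sx] [i ix defx]] := is_sqrootP xw.
have [ly [m' m0' sy] [j jy defy]] := is_sqrootP yw.
have /andP[rx0 rx] := square_rank_bound xw.
have /andP[ry0 ry] := square_rank_bound yw.
have sE := congr1 size E; rewrite !size_cyc in sE.
have px : (size (sqroot x)).*2 <= size x by rewrite sx leq_pmulr.
have py : (size (sqroot y)).*2 <= size y by rewrite sy leq_pmulr.
have rE : sqroot x = sqroot y.
  rewrite sE in E; apply: (lyndon_prefix_inj lx ly _ _ E); lia.
rewrite -rE in sy ry py sE.
have sxy : size x = size y.
  case: (ltngtP m m') => [lt|lt|mm]; last by rewrite sx sy mm.
  - have := leq_mul (leqnn (size (sqroot x)).*2) lt; rewrite mulnS -sx -sy; lia.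
  - have := leq_mul (leqnn (size (sqroot x)).*2) lt; rewrite mulnS -sx -sy; lia.
have : square_rank w x = square_rank w y by lia.
rewrite /square_rank (_ : square_class w y = square_class w x); last first.
  by apply: eq_filter => t; rewrite sxy rE.
move=> [] /(congr1 (nth [::] (square_class w x))).
by rewrite !nth_index // mem_filter ?xw ?yw ?sxy ?rE ?eqxx.
Qed.

(** * Runs of [false] *)

(* A word followed by a final [true] is encoded by the lengths of its (possibly
   empty) runs of [false]. *)
Definition enc (rl : seq nat) : word :=
  flatten [seq rcons (nseq i false) true | i <- rl].

Lemma enc_cons i rl : enc (i :: rl) = nseq i false ++ true :: enc rl.
Proof. by rewrite /enc /= cat_rcons. Qed.

Lemma enc_cat r1 r2 : enc (r1 ++ r2) = enc r1 ++ enc r2.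
Proof. by rewrite /enc map_cat flatten_cat. Qed.

Lemma enc_exists (w : word) : exists i rl, rcons w true = enc (i :: rl).
Proof.
elim: w => [|[] w [i [rl IHw]]] /=; first by exists 0, [::].
  by exists 0, (i :: rl); rewrite [RHS]enc_cons IHw.
by exists i.+1, rl; rewrite IHw !enc_cons.
Qed.

Lemma enc_inj : injective enc.
Proof.
elim=> [|i r IHr] [|j s] //; rewrite ?enc_cons.
- by case: j.
- by case: i.
elim: i j => [|i IHi] [|j] //= [/=]; first by move/IHr->.
by move/IHi => -[-> ->].
Qed.

Lemma count_enc rl : count_mem true (enc rl) = size rl.
Proof.
by elim: rl => // i rl IHrl; rewrite enc_cons count_cat count_nseq /= IHrl.
Qed.

Lemma size_enc rl : size (enc rl) = sumn rl + size rl.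
Proof.
by elim: rl => // i rl IHrl; rewrite enc_cons size_cat size_nseq /= IHrl; lia.
Qed.

Lemma enc_rcons rl i : enc (rcons rl i) = rcons (enc rl ++ nseq i false) true.
Proof. by rewrite -cats1 enc_cat enc_cons cats1 rcons_cat. Qed.

Lemma true_enc rl : exists s, true :: enc rl = rcons s true.
Proof.
case/lastP: rl => [|rl i]; first by exists [::].
by exists (true :: enc rl ++ nseq i false); rewrite enc_rcons.
Qed.

(** The last run [t] is taken without its closing [true], which may be the letter appended to
    [w]. *)
Lemma enc_factor (w : word) A B t C :
  rcons w true = enc (A ++ rcons B t ++ C) -> enc B ++ nseq t false \in factors w.
Proof.
rewrite 2!enc_cat enc_rcons cat_rcons.
have [s ->] := true_enc C; rewrite -!rcons_cat => /rcons_inj[->].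
exact: factors_cat.
Qed.

(** The last run of the prefix, the block and the first run of the suffix merge into a single
    run. *)
Lemma run_bound (w : word) rl c : rcons w true = enc rl ->
  nseq c false \in factors w -> exists2 i, i \in rl & c <= i.
Proof.
move=> defw /factorsP[p [s defws]].
have [i0 [P0]] := enc_exists p; rewrite lastI; set P := belast _ _; set i := last _ _.
rewrite enc_rcons => /rcons_inj[defp].
have [j [S]] := enc_exists s; rewrite enc_cons => defs.
exists (i + c + j); last by lia.
have -> : rl = P ++ (i + c + j) :: S.
  apply: enc_inj; rewrite -defw defws defp 2!rcons_cat defs.
  by rewrite enc_cat enc_cons !nseqD -!catA.
by rewrite mem_cat mem_head orbT.
Qed.

Lemma nseq_factors c d : c <= d -> nseq c false \in factors (nseq d false).
Proof.
by move=> le; rewrite -(subnKC le) nseqD; apply: (factors_cat [::]).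
Qed.

Lemma nseq_of_no_true (x : word) : true \notin x -> x = nseq (size x) false.
Proof.
move=> xF; apply/all_pred1P/allP => -[] // xT.
by rewrite xT in xF.
Qed.

Lemma unary_squares (w : word) L :
  (forall c, nseq c false \in factors w -> c <= L) ->
  size [seq x <- squares w | true \notin x] <= L./2.
Proof.
move=> HL; rewrite -(size_iota 1 L./2) -(size_map (fun m => nseq m.*2 false)).
apply: uniq_leq_size; first exact/filter_uniq/squares_uniq.
move=> x; rewrite mem_filter => /andP[/nseq_of_no_true xF xw].
have := squares_factors xw; rewrite xF => /HL sxL.
case/squaresP: xw => x0 [z defx] _.
apply/mapP; exists (size z); last by rewrite defx size_cat addnn.
have z0 : 0 < size z by case: (z) defx x0 => // ->.
rewrite defx size_cat in sxL.
by rewrite mem_iota; lia.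
Qed.

(** * Counting squares by disjoint families of edges *)

(** This separates the edges of non-unary squares from 0^j and 0^j 1: without its last letter, such
    an edge still has the root as a prefix. *)
Lemma true_in_edge (w x : word) : x \in squares w -> true \in x ->
  true \in take (size (square_edge w x)).-1 (square_edge w x).
Proof.
move=> xw; have [lu [m m0 sx] [i iu defx]] := is_sqrootP xw.
have /andP[r0 _] := square_rank_bound xw.
have px : (size (sqroot x)).*2 <= size x by rewrite sx leq_pmulr.
move=> xT; have uT : true \in sqroot x.
  move: xT; rewrite {1}defx => /mapP[t _ ->].
  by rewrite mem_nth // ltn_mod lyndon_size.
rewrite size_cyc take_cyc ?leq_pred //.
set N := _.-1; have le : size (sqroot x) <= N by rewrite /N; lia.
by rewrite -(subnKC le) cycD cyc_size mem_cat uT.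
Qed.

Lemma cyc_unary N : cyc [:: false] 0 N = nseq N false.
Proof.
apply: (@eq_from_nth _ false); rewrite ?size_cyc ?size_nseq // => i ltiN.
by rewrite nth_cyc // modn1 nth_nseq ltiN.
Qed.

(* The unary words and the words [0^j 1] are bypassed edges that are not images
   of non-unary squares under [square_edge]. *)
Lemma squares_count (w : word) L M X :
    nseq L false \in factors w ->
    (forall c, nseq c false \in factors w -> c <= L) ->
    (forall j, j <= M -> exists p q,
       w = p ++ nseq j false ++ true :: q /\ nseq j false \in factors q) ->
    uniq X ->
    {in X, forall e, [/\ true \in take (size e).-1 e, e \in factors w,
       bypassed w e & forall x : word, x \in squares w -> e <> square_edge w x]} ->
  num_squares w + (L - L./2) + M.+1 + size X <= size w.
Proof.
move=> Lw HL HM uX HX.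
pose R1 := [seq square_edge w x | x <- squares w & true \in x].
pose R2 := [seq nseq i false | i <- iota 1 L].
pose R3 := [seq rcons (nseq j false) true | j <- iota 0 M.+1].
have R1P (e : word) : e \in R1 ->
    exists2 x : word, x \in squares w /\ true \in x & e = square_edge w x.
  by case/mapP => x; rewrite mem_filter => /andP[? ?] ->; exists x.
have tR1 e : e \in R1 -> true \in take (size e).-1 e.
  by case/R1P => x [xw xT] ->; apply: true_in_edge.
have tR2 e : e \in R2 -> true \notin e.
  by case/mapP => i _ ->; rewrite mem_nseq andbF.
have tR3 e : e \in R3 -> (true \in e) && (true \notin take (size e).-1 e).
  case/mapP => j _ ->; rewrite mem_rcons mem_head /= size_rcons /= -cats1.
  by rewrite take_size_cat // mem_nseq andbF.
have sF : size [seq x <- squares w | true \in x] + L./2 >= num_squares w.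
  rewrite /num_squares -(count_predC (fun x => true \in x) (squares w)) -size_filter.
  by rewrite leq_add2l -size_filter; apply: unary_squares.
have : size (R1 ++ R2 ++ R3 ++ X) <= size w.
  apply: bypassed_total => [|e].
    rewrite !cat_uniq uX andbT !has_cat; apply/and5P; split.
    - rewrite map_inj_in_uniq ?filter_uniq ?squares_uniq // => x y.
      rewrite !mem_filter => /andP[_ xw] /andP[_ yw]; exact: square_edge_inj.
    - apply/negP => /or3P[] /hasP[e eR /=].
      + by move=> /tR1 /mem_take eT; move/tR2: eR; rewrite eT.
      + by move=> /tR1 eT; move/tR3: eR; rewrite eT andbF.
      + by move=> /R1P[x [xw _]]; have [_ _ _ /(_ x xw)] := HX _ eR.
    - rewrite map_inj_uniq ?iota_uniq // => i j /(congr1 size).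
      by rewrite !size_nseq.
    - apply/negP => /orP[] /hasP[e eR /tR2].
      + by case/andP: (tR3 _ eR) => ->.
      + by have [/mem_take -> ] := HX _ eR.
    - apply/andP; split.
        rewrite map_inj_uniq ?iota_uniq // => i j /(congr1 size).
        by rewrite !size_rcons !size_nseq => -[].
      apply/negP => /hasP[e eR /tR3].
      by have [-> ] := HX _ eR; rewrite andbF.
  have -> : (e \in R1 ++ R2 ++ R3 ++ X) = [|| e \in R1, e \in R2, e \in R3 | e \in X].
    by rewrite -!mem_cat.
  case/or4P => [/R1P[x [xw xT] ->]|/mapP[i + ->]|/mapP[j + ->]|eX].
  - have [lu [m m0 sx] _] := is_sqrootP xw.
    have /andP[r0 _] := square_rank_bound xw.
    have px : (size (sqroot x)).*2 <= size x by rewrite sx leq_pmulr.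
    split; first by rewrite -size_eq0 size_cyc; lia.
      exact: square_edge_in xw _ (lyndon_size lu).
    by apply: cyc_bypassed; [ | lia | apply: square_edge_in].
  - rewrite mem_iota add1n ltnS => /andP[i0 iL].
    have iw := factors_trans (nseq_factors iL) Lw.
    split=> //; first by rewrite -size_eq0 size_nseq -lt0n.
    rewrite -cyc_unary; apply: cyc_bypassed => // -[|t] // _.
    by rewrite cyc_unary.
  - rewrite mem_iota add0n ltnS /= => /HM[p [q [defw jq]]].
    split; [by case: (j) | | exact: nseq_true_bypassed defw jq].
    by rewrite defw -cat_rcons; apply: factors_cat.
  - have [eT ew be _] := HX _ eX; split=> //.
    by apply/negP => /eqP e0; rewrite e0 in eT.
rewrite !size_cat !size_map !size_iota.
set a := size [seq _ <- _ | _] in sF *; set b := size X; set n := size w.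
by move: a b n (num_squares w) sF => a b n s; lia.
Qed.

(** * Extra edges that come from no square *)

Lemma cyc_period u N : cyc u 0 (size u + N) = u ++ cyc u 0 N.
Proof.
rewrite cycD cyc_size add0n; congr (_ ++ _).
by apply: eq_cyc; rewrite modnn mod0n.
Qed.

(** The bound on [binval u] says that [u] starts with [t.+1] letters [false], while the rotation has
    [true] at index [t]. *)
Lemma lyndon_intro u : 0 < size u ->
    (forall i, 0 < i < size u -> exists t, [/\ t < size u,
       nth false u ((i + t) %% size u) & binval u < 2 ^ (size u - t.+1)]) ->
  lyndon u.
Proof.
move=> u0 Hu; apply/lyndonP; split=> // i /Hu[t [tu ut lt]].
apply: leq_trans lt _; rewrite -{1}(size_cyc u i (size u)).
by apply: binval_nth; rewrite nth_cyc.
Qed.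

Lemma power_extra (w : word) L (u := enc [:: L]) (e := cyc u 0 ((size u).*2.+1)) :
    enc [:: L; L; L] ++ nseq L false \in factors w ->
  [/\ true \in take (size e).-1 e, e \in factors w, bypassed w e
    & forall x : word, x \in squares w -> e <> square_edge w x].
Proof.
have defu : u = nseq L false ++ [:: true] by rewrite /u enc_cons.
have su : size u = L.+1 by rewrite defu size_cat size_nseq addn1.
have lu : lyndon u.
  apply: lyndon_intro; rewrite su // => i /andP[i0 iL]; exists (L - i); split.
  - by lia.
  - by rewrite subnKC // modn_small // defu nth_cat size_nseq ltnn subnn.
  - rewrite defu binval_cat binval_nseq0 mul0n add0n /= addn0 mul1n expn0.
    by rewrite -[1](expn0 2) ltn_exp2l //; lia.
have -> : enc [:: L; L; L] ++ nseq L false = cyc u 0 (size u + (size u + (size u + L))).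
  rewrite !cyc_period (_ : cyc u 0 L = nseq L false).
    by rewrite -[[:: L; L; L]]/([:: L] ++ [:: L] ++ [:: L]) !enc_cat -!catA.
  by rewrite -(@take_cyc u 0 L (size u)) ?su // -su cyc_size defu take_size_cat ?size_nseq.
move=> uw.
have cw : cyc_in w u (size u).*2.+1.
  move=> i ltiu; apply: factors_trans uw.
  by apply: cyc_factors => //; rewrite su in ltiu *; lia.
split.
- rewrite size_cyc take_cyc // -addnn cyc_period mem_cat defu mem_cat.
  by rewrite [true \in [:: true]]mem_head orbT.
- by apply: cw; rewrite su.
- by apply: cyc_bypassed => //; lia.
move=> x xw E; have sE := congr1 size E; rewrite !size_cyc in sE.
have [lx [m m0 sx] _] := is_sqrootP xw.
have /andP[rx0 rx] := square_rank_bound xw.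
have px : (size (sqroot x)).*2 <= size x by rewrite sx leq_pmulr.
have ru : u = sqroot x.
  rewrite /square_edge -sE in E; apply: (lyndon_prefix_inj lu lx _ _ E); lia.
rewrite -ru in sx rx sE; case: m sx m0 => [|[|m]] sx // _; first by lia.
have := leq_addr ((size u).*2 * m) ((size u).*2 * 2).
by rewrite -mulnDr addSn add1n -sx su in sE *; lia.
Qed.

(** Edges of squares of root [u] are longer than [u], so [u] itself is new. All its rotations occur
    in [u] followed by 0^L 1 0^x, which uses [x <= z]. *)
Lemma pair_extra (w : word) L x z (u := enc [:: L; x]) : x < L -> x <= z ->
    enc [:: L; x; L] ++ nseq z false \in factors w ->
  [/\ true \in take (size u).-1 u, u \in factors w, bypassed w u
    & forall y : word, y \in squares w -> u <> square_edge w y].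
Proof.
move=> xL xz.
have defu : u = nseq L false ++ true :: nseq x false ++ [:: true].
  by rewrite /u !enc_cons.
have su : size u = (L + x).+2.
  by rewrite defu size_cat /= size_cat !size_nseq /= addn1 !addnS.
have bu : binval u = 2 ^ x.+1 + 1.
  rewrite defu binval_cat /= binval_cat !binval_nseq0 size_cat size_nseq /=.
  by rewrite addn1 !mul0n mul1n.
have bu_lt t : x.+2 <= t -> binval u < 2 ^ t.
  move=> /(leq_pexp2l (isT : 0 < 2)); rewrite bu; apply: leq_trans.
  by rewrite (expnS 2 x.+1) mul2n -addnn -addnS leq_add2l expnS; have := expn_gt0 2 x; lia.
have lu : lyndon u.
  apply: lyndon_intro; rewrite su // => i /andP[i0 ix].
  (* The witness is the first [true] of the rotation, at index [L] or [L + x + 1] of [u]; the second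
     case needs [x < L]. *)
  have [iL|Li] := leqP i L.
    exists (L - i); split; [by lia| |by apply: bu_lt; lia].
    rewrite subnKC // modn_small; last by lia.
    by rewrite defu nth_cat size_nseq ltnn subnn.
  exists ((L + x).+1 - i); split; [by lia| |by apply: bu_lt; lia].
  rewrite subnKC // modn_small // defu nth_cat size_nseq ltnNge -addnS leq_addr /=.
  by rewrite addKn /= nth_cat size_nseq ltnn subnn.
have zw : cyc u 0 (size u + (L + x).+1) \in factors (enc [:: L; x; L] ++ nseq z false).
  rewrite cyc_period (_ : cyc u 0 (L + x).+1 = nseq L false ++ true :: nseq x false).
    rewrite -(subnKC xz) nseqD; apply/factorsP; exists [::], (nseq (z - x) false).
    rewrite cat0s -[[:: L; x; L]]/([:: L; x] ++ [:: L]) enc_cat -/u enc_cons.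
    by rewrite -!catA.
  rewrite -(@take_cyc u 0 _ (size u)) ?su // -su cyc_size defu -cat_cons catA.
  by rewrite take_size_cat // size_cat /= !size_nseq addnS.
move=> /(factors_trans zw) uw.
have cw : cyc_in w u (size u).
  move=> i ltiu; apply: factors_trans uw.
  by apply: cyc_factors => //; rewrite su in ltiu *; lia.
have u0 := lyndon_size lu.
split.
- rewrite su defu -cat_cons catA take_size_cat; last first.
    by rewrite size_cat /= !size_nseq addnS.
  by rewrite mem_cat mem_head orbT.
- by rewrite -[X in X \in _]cyc_size; apply: cw.
- by rewrite -[u]cyc_size; apply: cyc_bypassed.
move=> y yw E; have sE := congr1 size E; rewrite size_cyc in sE.
have [ly [m m0 sy] _] := is_sqrootP yw.
have /andP[ry0 ry] := square_rank_bound yw.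
have py : (size (sqroot y)).*2 <= size y by rewrite sy leq_pmulr.
have ru : u = sqroot y.
  rewrite -[u]cyc_size /square_edge -sE in E.
  by apply: (lyndon_prefix_inj lu ly _ _ E); lia.
by rewrite -ru in sE py; lia.
Qed.

(** * Run lengths and the final inequality *)

(** The last alternative says that the total shortfall of the runs from [L] is at least a third of
    their number, minus one. Blocks of 3 runs with shortfall at least 1, or of 6 with shortfall at
    least 2, are cut off until a pattern appears or at most 5 runs remain. *)
Lemma run_pattern L rl : all (fun i => i <= L) rl ->
  [\/ exists A C, rl = A ++ [:: L; L; L; L] ++ C,
      exists A x z C, [/\ rl = A ++ [:: L; x; L; z] ++ C, x < L & x <= z]
    | size rl + 3 * sumn rl <= 3 * L * size rl + 3].
Proof.
have [n] := ubnP (size rl); elim: n rl => // n IHn rl.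
have IH s t : rl = s ++ t -> 0 < size s -> size rl < n.+1 ->
    all (fun i => i <= L) t -> size s + 3 * sumn s <= 3 * L * size s ->
  [\/ exists A C, rl = A ++ [:: L; L; L; L] ++ C,
      exists A x z C, [/\ rl = A ++ [:: L; x; L; z] ++ C, x < L & x <= z]
    | size rl + 3 * sumn rl <= 3 * L * size rl + 3].
  move=> -> s0; rewrite size_cat => ltn aL ds.
  have [|[A [C ->]]|[A [x [z [C [-> xL xz]]]]]|dt] := IHn t _ aL; first by lia.
  - by apply: Or31; exists (s ++ A), C; rewrite catA.
  - by apply: Or32; exists (s ++ A), x, z, C; rewrite catA.
  - by apply: Or33; rewrite sumn_cat; nia.
case: rl IH => [|a [|b [|c r]]] IH ltn aL; try by apply: Or33; move: aL => /=; nia.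
have /and4P[aL1 bL cL rL] := aL.
case: (ltnP (a + b + c) (3 * L)) => [lt|ge].
  by apply: (IH [:: a; b; c] r) => //=; nia.
have [Ea [Eb Ec]] : a = L /\ b = L /\ c = L by lia.
subst a b c.
case: r IH ltn aL rL => [|x r] IH ltn aL rL; first by apply: Or33 => /=; nia.
case: (ltngtP x L) => [xL|Lx|xL]; last first.
- by apply: Or31; exists [::], r; rewrite xL.
- by move: rL => /=; lia.
case: r IH ltn aL rL => [|y [|z r]] IH ltn aL rL.
- by apply: Or33 => /=; nia.
- by apply: Or33; move: rL => /=; nia.
have /and4P[_ yL zL r'L] := rL.
case: (ltngtP y L) => [ltyL|Ly|EyL]; last first.
- subst y; case: (leqP x z) => xz.
    by apply: Or32; exists [:: L; L], x, z, r.
  by apply: (IH [:: L; L; L; x; L; z] r) => //=; nia.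
- by lia.
- by apply: (IH [:: L; L; L; x; y; z] r) => //=; nia.
Qed.

Lemma max_split (s : seq nat) : 0 < size s ->
  exists A L B, s = A ++ L :: B /\ all (fun i => i <= L) (A ++ B).
Proof.
case: s => // x s _; elim: s x => [|y s IHs] x; first by exists [::], x, [::].
have [A [L [B [-> aL]]]] := IHs y.
have [xL|Lx] := leqP x L.
  by exists (x :: A), L, B; rewrite /= xL.
exists [::], x, (A ++ L :: B); split=> //=.
move: aL; rewrite !all_cat /= (ltnW Lx) => /andP[aA aB].
by apply/andP; split; [apply: sub_all aA | apply: sub_all aB] => i /leq_trans;
  apply; apply: ltnW.
Qed.

Lemma leq_sumn L s : all (fun i => i <= L) s -> sumn s <= L * size s.
Proof. by elim: s => //= i s IHs /andP[iL /IHs]; rewrite mulnS; lia. Qed.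

(** The run [a] is cut so that exactly [j] letters [false] precede its [true]; the later run [c]
    supplies the second occurrence. *)
Lemma two_runs (w : word) A B a c j : rcons w true = enc (A ++ a :: B) ->
    c \in B -> j <= a -> j <= c ->
  exists p q, w = p ++ nseq j false ++ true :: q /\ nseq j false \in factors q.
Proof.
move=> defw cB ja jc; case/splitPr: B / cB defw => B1 B2 defw.
have [q defq] : exists q, rcons q true = enc (B1 ++ c :: B2).
  case: (lastP B2) => [|B' t]; first by exists (enc B1 ++ nseq c false); rewrite cats1 enc_rcons.
  by exists (enc (B1 ++ c :: B') ++ nseq t false); rewrite -enc_rcons -rcons_cons -rcons_cat.
exists (enc A ++ nseq (a - j) false), q; split.
  apply: (@rcons_injl _ true); rewrite defw enc_cat enc_cons -defq -catA.
  by rewrite -{1}(subnK ja) nseqD !rcons_cat rcons_cons -catA.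
apply: factors_trans (nseq_factors jc) _.
by apply: (@enc_factor q B1 [::] c B2); rewrite defq.
Qed.

Lemma squares_bound_true (w : word) (k := count_mem true w) : 1 < k ->
  (2 * k + 2) * num_squares w + 3 * size w <= (2 * k + 2) * size w.
Proof.
move=> k2; have [i [r]] := enc_exists w; set rl := i :: r => defw.
have srl : size rl = k.+1.
  by rewrite -count_enc -defw -cats1 count_cat addn1.
have sw : size w = sumn rl + k.
  by have := congr1 size defw; rewrite size_rcons size_enc srl; lia.
have [A [L [B [defrl aL]]]] := @max_split rl isT.
have sAB : size (A ++ B) = k.
  by move: srl; rewrite defrl !size_cat /=; lia.
have [A' [M [B' [defAB aM]]]] : exists A' M B',
    A ++ B = A' ++ M :: B' /\ all (fun i => i <= M) (A' ++ B').
  by apply: max_split; rewrite sAB; lia.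
have MAB : M \in A ++ B by rewrite defAB mem_cat mem_head orbT.
have ML : M <= L := allP aL M MAB.
have aL' : all (fun i => i <= L) rl.
  by move: aL; rewrite defrl !all_cat /= leqnn.
(* Besides [L], there are [k] runs of length at most [M]. *)
have sumrl : sumn rl <= L + k * M.
  have := leq_sumn aM; have := congr1 size defAB; have := congr1 sumn defAB.
  by rewrite defrl sAB !sumn_cat !size_cat /=; nia.
have HL c : nseq c false \in factors w -> c <= L.
  by case/(run_bound defw) => j /(allP aL') jL /leq_trans; apply.
have Lw : nseq L false \in factors w.
  by apply: (@enc_factor w A [::] L B); rewrite defw defrl.
have HM j : j <= M -> exists p q,
    w = p ++ nseq j false ++ true :: q /\ nseq j false \in factors q.
  move=> jM; rewrite defrl in defw; move: MAB; rewrite mem_cat => /orP[MA|MB].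
    case/splitPr: A / MA defw {defrl defAB aL sAB} => A1 A2.
    rewrite -catA => defw; apply: (two_runs defw (c := L)) => //.
      by rewrite mem_cat mem_head orbT.
    exact: leq_trans jM ML.
  by apply: (two_runs defw MB) => //; apply: leq_trans jM ML.
have H := squares_count Lw HL HM.
have H1 e : [/\ true \in take (size e).-1 e, e \in factors w, bypassed w e
    & forall x : word, x \in squares w -> e <> square_edge w x] ->
    num_squares w + (L - L./2) + M.+1 + 1 <= size w.
  by move=> He; apply: (H [:: e]) => // e'; rewrite mem_seq1 => /eqP->.
(* An extra edge gains 2k+2 in the final inequality, more than the k-2 that can be missing when
   [M = L]. *)
have [[A1 [C defrl']]|[A1 [x [z [C [defrl' xL xz]]]]]|sumrl'] := run_pattern aL'.
- rewrite defrl' in defw.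
  have e1 := power_extra (@enc_factor w A1 [:: L; L; L] L C defw).
  by have := H1 _ e1; rewrite sw; move: (num_squares w) => s; nia.
- rewrite defrl' in defw.
  have e1 := pair_extra xL xz (@enc_factor w A1 [:: L; x; L] z C defw).
  by have := H1 _ e1; rewrite sw; move: (num_squares w) => s; nia.
have {H1} : num_squares w + (L - L./2) + M.+1 + 0 <= size w by apply: (H [::]).
rewrite srl in sumrl'; rewrite sw.
move: (num_squares w) (sumn rl) sumrl sumrl' => s S.
(* Without an extra edge the margin is at least (k-2)(L-M-1), nonnegative for [M < L]. For [M = L],
   [sumrl'] lowers three times the sum of the runs by the missing k-2. *)
have [->|MneL] := eqVneq M L; first by nia.
have : M < L by rewrite ltn_neqAle MneL.
by nia.
Qed.

Lemma num_squares_negb (w : word) : num_squares w <= num_squares (map negb w).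
Proof.
rewrite /num_squares -(size_map (map negb) (squares w)); apply: uniq_leq_size.
  by rewrite map_inj_uniq ?squares_uniq //; apply/inj_map/negb_inj.
move=> _ /mapP[x /squaresP[x0 [z defx] [p [s ->]]] ->]; apply/squaresP; split.
- by case: (x) x0.
- by exists (map negb z); rewrite defx map_cat.
- by exists (map negb p), (map negb s); rewrite !map_cat.
Qed.

(** If [false] attains the minimum, exchanging the two letters reduces to [squares_bound_true]. *)
Lemma squares_bound (w : word) (k := minn (count_mem true w) (count_mem false w)) :
  1 < k -> (2 * k + 2) * num_squares w + 3 * size w <= (2 * k + 2) * size w.
Proof.
rewrite /k /minn; case: ifP => _; first exact: squares_bound_true.
have E : count_mem false w = count_mem true (map negb w).
  by rewrite count_map; apply: eq_count => -[].
rewrite E => /squares_bound_true; rewrite size_map; apply: leq_trans.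
by rewrite leq_add2r leq_mul2l num_squares_negb orbT.
Qed.

Local Open Scope ring_scope.

Theorem theorem2 (w : word) :
  let k := minn (count_mem true w) (count_mem false w) in
  (2 <= k)%N ->
  (num_squares w)%:R <= (2 * k%:R - 1) / (2 * k%:R + 2) * (size w)%:R :> rat.
Proof.
move=> k k2; have := squares_bound k2; rewrite -/k => H.
(* Since [2 <= k], the subtraction in [nat] does not truncate. *)
have -> : 2 * k%:R - 1 = (2 * k - 1)%N%:R :> rat by rewrite natrB ?natrM //; lia.
have -> : 2 * k%:R + 2 = (2 * k + 2)%N%:R :> rat by rewrite natrD natrM.
rewrite mulrAC ler_pdivlMr ?ltr0n ?addn2 // -!natrM ler_nat.
by rewrite -addn2; nia.
Qed.
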